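(* Let $R$ be an $F$-finite regular domain of characteristic $p>0$ and let $f\in R$ be nonzero. For every $e\geq 1$ and $i_1,\ldots,i_e\in\{0,\ldots,p-1\}$, the set $\{Q_{i_1,\ldots,i_e}^m : m\geq 0\}$ is an $R$-basis of $(B_f)_{i_1,\ldots,i_e}$. Moreover, if $1\leq\ell\leq e$ and $m\ge 0$, then the following hold: (i) $\partial_t^{[p^{\ell-1}]}\cdot Q_{i_1,\ldots,i_e}^m=-(i_{\ell}+1)\,Q_{i_1,\ldots,i_{\ell}+1,\ldots,i_e}^m$ (when $i_\ell=p-1$, the right-hand side is understood to be zero). (ii) If not all of $i_\ell,\ldots,i_e$ are $0$, let $k\in\{\ell,\ldots,e\}$ be the smallest index with $i_k\neq 0$; then $$t^{p^{\ell-1}}\cdot Q_{i_1,\ldots,i_e}^m=Q^m_{i_1,\ldots,i_{\ell-1},p-1,\ldots,p-1,i_k-1,i_{k+1},\ldots,i_e},$$ where the entries $p-1$ are in positions $\ell,\ldots,k-1$ (there are none if $k=\ell$). If $i_\ell=\cdots=i_e=0$, then $$t^{p^{\ell-1}}\cdot Q_{i_1,\ldots,i_e}^m=f^{p^e}Q_{i_1,\ldots,i_{\ell-1},p-1,\ldots,p-1}^m-Q_{i_1,\ldots,i_{\ell-1},p-1,\ldots,p-1}^{m-1},$$ where the entries $p-1$ are in positions $\ell,\ldots,e$, and where $Q^{-1}_{j_1,\ldots,j_e}=0$ for all $j_1,\ldots,j_e$. (iii) $R\cdot Q_{i_1,\ldots,i_e}^m$ is a $D_R^e$-submodule of $B_f$,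 isomorphic to $R$ (as a $D_R^e$-module) by an isomorphism that takes $Q_{i_1,\ldots,i_e}^m$ to $1$.
   Context: $R$ is $F$-finite if the Frobenius map $u\mapsto u^p$ on $R$ is finite. For $e\ge 0$ let $D_R^e=\mathrm{End}_{R^{p^e}}(R)$ and $D_{R[t]}^e=\mathrm{End}_{R[t]^{p^e}}(R[t])$; the action of an operator $P$ on a ring element $h$ is denoted $P\bullet h$. $D_R^e$ is viewed inside $D_{R[t]}^e$ by acting on coefficients. The operators $\partial_t^{[m]}$ are $R$-linear with $\partial_t^{[m]}\bullet t^r=\binom{r}{m}t^{r-m}$ ($\binom{r}{m}=0$ if $r<m$), and $\partial_t^{[m]}\in D_{R[t]}^e$ if $m<p^e$. Put $\theta_m=\partial_t^{[m]}t^m$ (composition: multiply by $t^m$, then apply $\partial_t^{[m]}$). $B_f=R[t]_{f-t}/R[t]$. Every element of $R[t]_{f-t}$ can be written $h/(f-t)^{Np^e}$ with $h\in R[t]$, $N\ge 0$, and $P\in D_{R[t]}^e$ acts by $P\cdot \frac{h}{(f-t)^{Np^e}}=\frac{P\bullet h}{(f-t)^{Np^e}}$; this induces a left $D_{R[t]}^e$-module structure on $B_f$. For $i_1,\ldots,i_e\in\{0,\ldots,p-1\}$, the component $(B_f)_{i_1,\ldots,i_e}$ is the set of $w\in B_f$ with $\theta_{p^{\ell-1}}w=-i_\ell w$ for all $1\le\ell\le e$ ($i_\ell$ taken modulo $p$). For $m\ge 0$, $Q_{i_1,\ldots,i_e}^m\in B_f$ is the class of $$t^{\sum_{\ell=1}^e(p-i_\ell-1)p^{\ell-1}}\cdot\frac{1}{(f-t)^{(m+1)p^e}}.$$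 *)

(* Defs.v *)
From HB Require Import structures.
From mathcomp Require Import all_boot all_order all_algebra.
From mathcomp Require Import ring_quotient.
From mathcomp Require Import boolp classical_sets functions.

Set Implicit Arguments.
Unset Strict Implicit.
Unset Printing Implicit Defensive.

Import GRing.Theory.
Local Open Scope ring_scope.
Local Open Scope quotient_scope.

(* Restriction of scalars of the [B]-module [M] along [phi : A -> B]. *)
Definition restr (A B : pzRingType) (phi : {rmorphism A -> B})
  (M : lmodType B) : Type := M.

Section Restr.
Variables (A B : pzRingType) (phi : {rmorphism A -> B}) (M : lmodType B).

HB.instance Definition _ := GRing.Zmodule.on (restr phi M).

Definition restr_scale (a : A) (m : restr phi M) : restr phi M :=
  phi a *: (m : M).

Fact restr_scaleA a b m :
  restr_scale a (restr_scale b m) = restr_scale (a * b) m.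
Proof. by rewrite /restr_scale scalerA rmorphM. Qed.

Fact restr_scale1 : left_id 1 restr_scale.
Proof. by move=> m; rewrite /restr_scale rmorph1 scale1r. Qed.

Fact restr_scaleDr : right_distributive restr_scale +%R.
Proof. by move=> a m n; rewrite /restr_scale; exact: scalerDr. Qed.

Fact restr_scaleDl m : {morph restr_scale^~ m : a b / a + b}.
Proof. by move=> a b; rewrite /restr_scale rmorphD; exact: scalerDl. Qed.

HB.instance Definition _ := GRing.Zmodule_isLmodule.Build A (restr phi M)
  restr_scaleA restr_scale1 restr_scaleDr restr_scaleDl.

End Restr.

Definition is_basis (A : pzRingType) (M : lmodType A) (S : set M)
    (b : nat -> M) : Prop :=
  (forall (n : nat) (c : nat -> A),
     \sum_(i < n) c i *: b i = 0 -> forall i : 'I_n, c i = 0) /\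
  (forall w : M,
     S w <-> exists (n : nat) (c : nat -> A), w = \sum_(i < n) c i *: b i).

Definition cyclic_sub (A : pzRingType) (M : lmodType A) (v : M) : set M :=
  [set w | exists a : A, w = a *: v].

Definition is_submodule (A : pzRingType) (M : lmodType A) (S : set M) : Prop :=
  [/\ S 0, forall u v, S u -> S v -> S (u + v)
    & forall (a : A) u, S u -> S (a *: u)].

(* Only the values of [phi] on [S] matter. *)
Definition is_module_iso (A : pzRingType) (M N : lmodType A) (S : set M)
    (phi : M -> N) : Prop :=
  [/\ forall u v, S u -> S v -> phi (u + v) = phi u + phi v,
      forall (a : A) u, S u -> phi (a *: u) = a *: phi u,
      forall u v, S u -> S v -> phi u = phi v -> u = v
    & forall y : N, exists2 u, S u & phi u = y].

(* When [0 \in S] this is the localization at [S \ {0}]; below [S] is always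
   the complement of a prime ideal, or the powers of [f - t]. *)
Definition loc_pred (A : idomainType) (S : mulrClosed A) :
    {pred {fraction A}} :=
  fun x => `[< exists2 as_ : A * A, as_.2 \in S &
               x = tofrac as_.1 / tofrac as_.2 >].

Section Loc.
Variables (A : idomainType) (S : mulrClosed A).

Fact loc_predP : subring_closed (loc_pred S).
Proof.
have frac0 (a : A) : a = 0 -> tofrac a = 0 by move=> ->; rewrite rmorph0.
split.
- apply/asboolP; exists (1, 1); first exact: rpred1.
  by rewrite /= rmorph1 divr1.
- move=> x y /asboolP[[a s] /= sS ->] /asboolP[[b t] /= tS ->].
  apply/asboolP; have [->|s0] := eqVneq s 0.
    exists (- b, t) => //=.
    by rewrite rmorph0 invr0 mulr0 sub0r rmorphN mulNr.
  have [->|t0] := eqVneq t 0.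
    by exists (a, s) => //=; rewrite rmorph0 invr0 mulr0 subr0.
  exists (a * t - b * s, s * t) => /=; first exact: rpredM.
  by rewrite -mulNr addf_div ?tofrac_eq0// -rmorphN -!rmorphM -rmorphD mulNr.
- move=> x y /asboolP[[a s] /= sS ->] /asboolP[[b t] /= tS ->].
  apply/asboolP; exists (a * b, s * t) => /=; first exact: rpredM.
  by rewrite !rmorphM invfM mulrACA.
Qed.

HB.instance Definition _ :=
  GRing.isSubringClosed.Build {fraction A} (loc_pred S) loc_predP.

Record loc := Loc { loc_val : {fraction A}; _ : loc_val \in loc_pred S }.

HB.instance Definition _ := [isSub for loc_val].
HB.instance Definition _ := [Choice of loc by <:].
HB.instance Definition _ := [SubChoice_isSubComNzRing of loc by <:].

Fact loc_of_subproof (a : A) : tofrac a \in loc_pred S.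
Proof.
by apply/asboolP; exists (a, 1); rewrite ?rpred1//= rmorph1 divr1.
Qed.

Lemma locP (x : loc) : exists a s, s \in S /\ val x = tofrac a / tofrac s.
Proof. by case: x => x /=/asboolP[[a s] sS ->]; exists a, s. Qed.

Definition loc_of (a : A) : loc := Loc (loc_of_subproof a).

Fact loc_of_zmod : zmod_morphism loc_of.
Proof. by move=> a b; apply: val_inj; rewrite rmorphB /= rmorphB. Qed.

Fact loc_of_monoid : monoid_morphism loc_of.
Proof.
by split=> [|a b]; apply: val_inj; rewrite ?rmorph1 ?rmorphM /= ?rmorph1 ?rmorphM.
Qed.

HB.instance Definition _ := GRing.isZmodMorphism.Build A loc loc_of loc_of_zmod.
HB.instance Definition _ :=
  GRing.isMonoidMorphism.Build A loc loc_of loc_of_monoid.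

Definition loc_int : {pred loc} := fun x => `[< exists a, x = loc_of a >].

Fact loc_intP : zmod_closed loc_int.
Proof.
split; first by apply/asboolP; exists 0; rewrite rmorph0.
move=> x y /asboolP[a ->] /asboolP[b ->].
by apply/asboolP; exists (a - b); rewrite rmorphB.
Qed.

HB.instance Definition _ := GRing.isZmodClosed.Build loc loc_int loc_intP.

End Loc.

Arguments loc_int {A} S.

Section Regular.
Variable A : comNzRingType.

Definition generates (s : seq A) (I : idealr A) : Prop :=
  forall x, x \in I <->
    exists c : nat -> A, x = \sum_(i < size s) c i * s`_i.

(* [idealr] only ranges over the proper ideals; the unit ideal is always
   generated by [1]. *)
Definition noetherian : Prop :=
  forall I : idealr A, exists s : seq A, generates s I.

Definition krull_dim_ge (n : nat) : Prop :=
  exists P : nat -> prime_idealr A, forall k, (k < n)%N ->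
    {subset P k <= P k.+1} /\ ~ {subset P k.+1 <= P k}.

Definition krull_dim (n : nat) : Prop :=
  krull_dim_ge n /\ ~ krull_dim_ge n.+1.

Definition is_maximal (m : idealr A) : Prop :=
  forall I : idealr A, {subset m <= I} -> {subset I <= m}.

Definition local_ring (m : idealr A) : Prop :=
  is_maximal m /\ forall m' : idealr A, is_maximal m' -> m' =i m.

Definition regular_local : Prop :=
  noetherian /\
  exists m : idealr A, local_ring m /\
    exists s : seq A, krull_dim (size s) /\ generates s m.

End Regular.

Definition prime_compl (A : comNzRingType) (P : prime_idealr A) : {pred A} :=
  fun x => x \notin P.

Fact prime_complP (A : comNzRingType) (P : prime_idealr A) :
  mulr_closed (prime_compl P).
Proof.
split; first by apply/negbT/idealr1.
move=> x y xP yP; apply/negP => /prime_idealr_closed_subproof.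
by apply/negP; rewrite negb_or; apply/andP.
Qed.

HB.instance Definition _ (A : comNzRingType) (P : prime_idealr A) :=
  GRing.isMulClosed.Build A (prime_compl P) (prime_complP P).

Definition prime_mset (A : comNzRingType) (P : prime_idealr A) : mulrClosed A :=
  GRing.MulClosed.clone A (prime_compl P) _.

Definition regular (A : idomainType) : Prop :=
  noetherian A /\
  forall P : prime_idealr A, regular_local (loc (prime_mset P)).

Definition finite_morphism (A B : comNzRingType) (phi : {rmorphism A -> B}) :
    Prop :=
  exists s : seq B, forall b : B,
    exists c : nat -> A, b = \sum_(i < size s) phi (c i) * s`_i.

Definition F_finite (A : comNzRingType) (p : nat) (chA : p \in [pchar A]) :
    Prop :=
  finite_morphism (pFrobenius_aut chA).

Definition Dop_pred (p e : nat) (A : comNzRingType) : {pred A -> A} :=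
  fun P => `[< {morph P : x y / x + y} /\
               forall a x, P (a ^+ (p ^ e) * x) = a ^+ (p ^ e) * P x >].

(* [A] as a left module over [Dop p e A] (defined below), with
   [P *: x = P x]. *)
Definition Dreg (p e : nat) (A : comNzRingType) : Type := A.

Section Dop.
Variables (p e : nat) (A : comNzRingType).

Fact Dop_predP : zmod_closed (@Dop_pred p e A).
Proof.
split.
  by apply/asboolP; split=> [x y|a x] /=; rewrite ?addr0 ?mulr0.
move=> P P' /asboolP[PD PZ] /asboolP[PD' PZ'].
apply/asboolP; split=> [x y|a x].
  have E z : (P - P') z = P z - P' z by [].
  by rewrite !E PD PD' opprD addrACA.
have E z : (P - P') z = P z - P' z by [].
by rewrite !E PZ PZ' mulrBr.
Qed.

HB.instance Definition _ :=
  GRing.isZmodClosed.Build (A -> A) (@Dop_pred p e A) Dop_predP.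

(* [Dop p e A] is the ring of endomorphisms of [A] as a module over its subring
   of [p ^ e]-th powers; the product is composition. *)
Record Dop := MkDop { Dop_fun :> A -> A; _ : Dop_fun \in @Dop_pred p e A }.

HB.instance Definition _ := [isSub for Dop_fun].
HB.instance Definition _ := [Choice of Dop by <:].
HB.instance Definition _ := [SubChoice_isSubZmodule of Dop by <:].

Lemma DopD (P : Dop) x y : P (x + y) = P x + P y.
Proof. by case: P => P /= /asboolP[-> _]. Qed.

Lemma DopZ (P : Dop) a x : P (a ^+ (p ^ e) * x) = a ^+ (p ^ e) * P x.
Proof. by case: P => P /= /asboolP[_ ->]. Qed.

Lemma Dop0 (P : Dop) : P 0 = 0.
Proof. by apply: (addrI (P 0)); rewrite -DopD !addr0. Qed.

Lemma DopN (P : Dop) x : P (- x) = - P x.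
Proof. by apply/eqP; rewrite -addr_eq0 -DopD addNr Dop0. Qed.

Lemma DopB (P : Dop) x y : P (x - y) = P x - P y.
Proof. by rewrite DopD DopN. Qed.

Lemma Dop_ext (P P' : Dop) : P =1 P' -> P = P'.
Proof. by move=> PP'; apply: val_inj; apply: funext. Qed.

Lemma add_DopE (P P' : Dop) x : (P + P') x = P x + P' x.
Proof. by []. Qed.

Lemma sub_DopE (P P' : Dop) x : (P - P') x = P x - P' x.
Proof. by []. Qed.

Fact Dop_one_subproof : (idfun : A -> A) \in @Dop_pred p e A.
Proof. by apply/asboolP. Qed.

Definition Dop_one : Dop := MkDop Dop_one_subproof.

Fact Dop_mul_subproof (P P' : Dop) :
  (fun x => P (P' x)) \in @Dop_pred p e A.
Proof. by apply/asboolP; split=> [x y|a x]; rewrite ?DopD ?DopZ. Qed.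

Definition Dop_mul (P P' : Dop) : Dop := MkDop (Dop_mul_subproof P P').

Fact Dop_mulA : associative Dop_mul.
Proof. by move=> P P' P''; apply: Dop_ext. Qed.

Fact Dop_mul1 : left_id Dop_one Dop_mul.
Proof. by move=> P; apply: Dop_ext. Qed.

Fact Dop_mulr1 : right_id Dop_one Dop_mul.
Proof. by move=> P; apply: Dop_ext. Qed.

Fact Dop_mulDl : left_distributive Dop_mul +%R.
Proof. by move=> P P' P''; apply: Dop_ext. Qed.

Fact Dop_mulDr : right_distributive Dop_mul +%R.
Proof. by move=> P P' P''; apply: Dop_ext => x /=; rewrite DopD. Qed.

HB.instance Definition _ := GRing.Zmodule_isPzRing.Build Dop
  Dop_mulA Dop_mul1 Dop_mulr1 Dop_mulDl Dop_mulDr.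

Lemma mul_DopE (P P' : Dop) x : (P * P') x = P (P' x).
Proof. by []. Qed.

Fact mulop_subproof (a : A) : (fun x => a * x) \in @Dop_pred p e A.
Proof.
by apply/asboolP; split=> [x y|b x]; rewrite ?mulrDr// mulrCA.
Qed.

Definition mulop (a : A) : Dop := MkDop (mulop_subproof a).

Local Notation DA := (Dreg p e A).

HB.instance Definition _ := GRing.Zmodule.on DA.

Definition Dreg_scale (P : Dop) (x : DA) : DA := P (x : A).

Fact Dreg_scaleA P P' x :
  Dreg_scale P (Dreg_scale P' x) = Dreg_scale (P * P') x.
Proof. by []. Qed.

Fact Dreg_scale1 : left_id 1 Dreg_scale.
Proof. by []. Qed.

Fact Dreg_scaleDr : right_distributive Dreg_scale +%R.
Proof. by move=> P x y; exact: DopD. Qed.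

Fact Dreg_scaleDl x : {morph Dreg_scale^~ x : P P' / P + P'}.
Proof. by []. Qed.

HB.instance Definition _ := GRing.Zmodule_isLmodule.Build Dop DA
  Dreg_scaleA Dreg_scale1 Dreg_scaleDr Dreg_scaleDl.

End Dop.

Definition powers (A : comNzRingType) (g : A) : {pred A} :=
  fun x => `[< exists n : nat, x = g ^+ n >].

Fact powersP (A : comNzRingType) (g : A) : mulr_closed (powers g).
Proof.
split; first by apply/asboolP; exists 0%N.
move=> x y /asboolP[n ->] /asboolP[m ->].
by apply/asboolP; exists (n + m)%N; rewrite exprD.
Qed.

HB.instance Definition _ (A : comNzRingType) (g : A) :=
  GRing.isMulClosed.Build A (powers g) (powersP g).

Definition power_mset (A : comNzRingType) (g : A) : mulrClosed A :=
  GRing.MulClosed.clone A (powers g) _.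

Section LocQuot.
Variables (A : idomainType) (g : A).

Local Notation Ag := (loc (power_mset g)).

Fact lfrac_subproof (h : A) (n : nat) :
  tofrac h / tofrac g ^+ n \in loc_pred (power_mset g).
Proof.
apply/asboolP; exists (h, g ^+ n); last by rewrite /= rmorphXn.
by apply/asboolP; exists n.
Qed.

Definition lfrac (h : A) (n : nat) : Ag := Loc (lfrac_subproof h n).

Definition locquot : Type :=
  Quotient.quot (loc_int (power_mset g)).

HB.instance Definition _ := GRing.Zmodule.on locquot.

Definition lclass (x : Ag) : locquot :=
  \pi_(Quotient.quot (loc_int (power_mset g))) x.

Lemma lclassD : {morph lclass : x y / x + y}.
Proof. by move=> x y; exact: raddfD. Qed.

Lemma lclass_eq x y : lclass x = lclass y <-> exists a, x - y = loc_of _ a.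
Proof.
rewrite /lclass; split=> [/eqP|[a E]].
  by rewrite -Quotient.idealrBE => /asboolP[a]; exists a.
by apply/eqP; rewrite -Quotient.idealrBE; apply/asboolP; exists a.
Qed.

Lemma locquot_triv (w w' : locquot) : g = 0 -> w = w'.
Proof.
have int (x : Ag) : g = 0 -> exists a, x = loc_of _ a.
  move=> g0; have [h [s [/asboolP[n ->{s}]]]] := locP x.
  case: n => [|n] E.
    by exists h; apply: val_inj; rewrite E /= expr0 rmorph1 divr1.
  exists 0; apply: val_inj.
  by rewrite E /= exprS {1}g0 mul0r rmorph0 invr0 mulr0.
move=> g0; rewrite -[w]reprK -[w']reprK; apply/lclass_eq; exact: int.
Qed.

Lemma lclass_surj (w : locquot) : exists x, w = lclass x.
Proof. by exists (repr w); rewrite /lclass reprK. Qed.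

Definition locquot_scale (a : A) (w : locquot) : locquot :=
  lclass (loc_of _ a * repr w).

Lemma locquot_scale_class a x :
  locquot_scale a (lclass x) = lclass (loc_of _ a * x).
Proof.
apply/lclass_eq; have /lclass_eq[b E] : lclass (repr (lclass x)) = lclass x.
  by rewrite /lclass reprK.
by exists (a * b); rewrite -mulrBr E rmorphM.
Qed.

Fact locquot_scaleA a b w :
  locquot_scale a (locquot_scale b w) = locquot_scale (a * b) w.
Proof.
have [x ->] := lclass_surj w.
by rewrite !locquot_scale_class rmorphM mulrA.
Qed.

Fact locquot_scale1 : left_id 1 locquot_scale.
Proof.
move=> w; have [x ->] := lclass_surj w.
by rewrite locquot_scale_class rmorph1 mul1r.
Qed.

Fact locquot_scaleDr : right_distributive locquot_scale +%R.
Proof.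
move=> a w w'; have [x ->] := lclass_surj w; have [y ->] := lclass_surj w'.
by rewrite -lclassD !locquot_scale_class mulrDr lclassD.
Qed.

Fact locquot_scaleDl w : {morph locquot_scale^~ w : a b / a + b}.
Proof.
move=> a b; have [x ->] := lclass_surj w.
by rewrite !locquot_scale_class rmorphD mulrDl lclassD.
Qed.

HB.instance Definition _ := GRing.Zmodule_isLmodule.Build A locquot
  locquot_scaleA locquot_scale1 locquot_scaleDr locquot_scaleDl.

Lemma scale_lclass a x : a *: lclass x = lclass (loc_of _ a * x).
Proof. exact: locquot_scale_class. Qed.

End LocQuot.

(* [locquot g], seen as a left module over [Dop p e A]. *)
Definition locquotD (p : nat) (pr_p : prime p) (e : nat) (A : idomainType)
  (g : A) : Type := locquot g.

Section LocQuotD.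
Variables (p : nat) (pr_p : prime p) (e : nat) (A : idomainType) (g : A).

Local Notation q := (p ^ e)%N.
Local Notation M := (locquotD pr_p e g).
Local Notation D := (Dop p e A).

HB.instance Definition _ := GRing.Zmodule.on M.

Fact lfrac_exists (x : loc (power_mset g)) :
  exists hN : A * nat, x == lfrac g hN.1 (hN.2 * q).
Proof.
have [h [s [/asboolP[n ->{s}] E]]] := locP x.
have [g0|g0] := eqVneq g 0.
  case: n E => [|n] E.
    exists (h, 0%N); apply/eqP/val_inj; rewrite E /=.
    by rewrite expr0 mul0n expr0 rmorph1.
  exists (0, 0%N); apply/eqP/val_inj; rewrite E /=.
  by rewrite exprS {1}g0 mul0r rmorph0 invr0 mulr0 mul0r.
have q0 : (0 < q)%N by rewrite expn_gt0 prime_gt0.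
exists (h * g ^+ (n * q - n), n); apply/eqP/val_inj; rewrite E /=.
rewrite rmorphM !rmorphXn -{2}(subnK (leq_pmulr n q0)) exprD.
by rewrite [X in _ = _ / X]mulrC -mulf_div divff ?mulr1// expf_neq0 ?tofrac_eq0.
Qed.

(* [P . (h / g ^ (N q)) = P(h) / g ^ (N q)]; [locquotD_scale_class] below shows
   that the chosen expression of the representative does not matter. *)
Definition locquotD_scale (P : D) (w : M) : M :=
  let hN := xchoose (lfrac_exists (repr (w : locquot g))) in
  lclass (lfrac g (P hN.1) (hN.2 * q)).

Lemma locquotD_scale_class (P : D) (h : A) (N : nat) :
  locquotD_scale P (lclass (lfrac g h (N * q)) : M) =
  lclass (lfrac g (P h) (N * q)).
Proof.
rewrite /locquotD_scale.
have /eqP := xchooseP (lfrac_exists (repr (lclass (lfrac g h (N * q))))).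
case: (xchoose _) => h' N' /= E.
have [g0|g0] := eqVneq g 0.
  exact: locquot_triv.
have G0 n : tofrac g ^+ n != 0 by rewrite expf_neq0 ?tofrac_eq0.
have cross (u v a : A) (m n : nat) :
    lfrac g u m - lfrac g v n = loc_of _ a <->
    u * g ^+ n - v * g ^+ m = a * g ^+ (m + n).
  have H : (lfrac g u m - lfrac g v n = loc_of _ a) <->
            (tofrac u / tofrac g ^+ m - tofrac v / tofrac g ^+ n = tofrac a).
    split=> [/(congr1 val)|Ea]; first by rewrite rmorphB.
    by apply: val_inj; rewrite rmorphB.
  apply: (iff_trans H); rewrite -mulNr addf_div// mulNr; split=> [Ea|Ea].
    apply/eqP; rewrite -tofrac_eq; apply/eqP.
    rewrite tofracB !tofracM !tofracXn exprD -Ea.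
    by rewrite divfK// mulf_neq0.
  have := congr1 (@tofrac A) Ea.
  rewrite tofracB !tofracM !tofracXn exprD => E1.
  by rewrite E1 mulfK// mulf_neq0.
have /lclass_eq[a] : lclass (lfrac g h' (N' * q)) = lclass (lfrac g h (N * q)).
  by rewrite -E /lclass reprK.
move=> /cross Ea; apply/lclass_eq; exists (P a); apply/cross.
have X n x : P (g ^+ (n * q) * x) = g ^+ (n * q) * P x.
  by rewrite exprM DopZ.
by move/(congr1 P): Ea; rewrite DopB -mulnDl !(mulrC _ (g ^+ _)) !X.
Qed.

Lemma lclassD_surj (w : M) :
  exists h N, w = lclass (lfrac g h (N * q)) :> locquot g.
Proof.
have [x ->] := lclass_surj (w : locquot g).
by have [[h N] /eqP->] := lfrac_exists x; exists h, N.
Qed.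

Fact lfrac_same h h' n : lfrac g h n + lfrac g h' n = lfrac g (h + h') n.
Proof. by apply: val_inj; rewrite rmorphD /= rmorphD mulrDl. Qed.

Fact locquotD_scaleA P P' w :
  locquotD_scale P (locquotD_scale P' w) = locquotD_scale (P * P') w.
Proof.
have [h [N ->]] := lclassD_surj w.
by rewrite !locquotD_scale_class.
Qed.

Fact locquotD_scale1 : left_id 1 locquotD_scale.
Proof.
move=> w; have [h [N ->]] := lclassD_surj w.
by rewrite locquotD_scale_class.
Qed.

Fact locquotD_scaleDr : right_distributive locquotD_scale +%R.
Proof.
move=> P w w'; have [h [N ->]] := lclassD_surj w.
have [h' [N' ->]] := lclassD_surj w'.
have [g0|g0] := eqVneq g 0.
  exact: (locquot_triv _ _ g0).
have up (u : A) m k : lfrac g u (m * q) = lfrac g ((g ^+ k) ^+ q * u) ((k + m) * q).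
  apply: val_inj; rewrite -exprM /= tofracM tofracXn mulnDl exprD.
  by rewrite -[RHS]mulf_div divff ?mul1r// expf_neq0 ?tofrac_eq0.
rewrite !locquotD_scale_class (up h N N') (up h' N' N) (addnC N').
rewrite -[X in locquotD_scale P X]lclassD lfrac_same locquotD_scale_class DopD.
rewrite !DopZ (up (P h) N N') (up (P h') N' N) (addnC N').
by rewrite -[RHS]lclassD lfrac_same.
Qed.

Fact locquotD_scaleDl w : {morph locquotD_scale^~ w : P P' / P + P'}.
Proof.
move=> P P'; have [h [N ->]] := lclassD_surj w.
by rewrite !locquotD_scale_class -[RHS]lclassD lfrac_same.
Qed.

HB.instance Definition _ := GRing.Zmodule_isLmodule.Build D M
  locquotD_scaleA locquotD_scale1 locquotD_scaleDr locquotD_scaleDl.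

Lemma scaleD_lclass (P : D) (h : A) (N : nat) :
  P *: (lclass (lfrac g h (N * q)) : M) = lclass (lfrac g (P h) (N * q)).
Proof. exact: locquotD_scale_class. Qed.

Lemma scaleD_mulop (a : A) (w : M) : mulop p e a *: w = a *: (w : locquot g).
Proof.
have [h [N ->]] := lclassD_surj w; rewrite scaleD_lclass scale_lclass.
by congr lclass; apply: val_inj; rewrite /= tofracM mulrA.
Qed.

End LocQuotD.

Section PolyOps.
Variables (A : comNzRingType) (p : nat) (chA : p \in [pchar A]) (e : nat).

Local Notation q := (p ^ e)%N.

Let pr_p : prime p := pcharf_prime chA.
Let q_gt0 : (0 < q)%N. Proof. by rewrite expn_gt0 prime_gt0. Qed.

Lemma Dop_polyP (G : {poly A} -> {poly A}) :
    {morph G : u v / u + v} ->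
    (forall c u, G ((c ^+ q)%:P * u) = (c ^+ q)%:P * G u) ->
    (forall u, G ('X^q * u) = 'X^q * G u) ->
  G \in @Dop_pred p e {poly A}.
Proof.
move=> GD GC GX; apply/asboolP; split=> // a.
have chP : p \in [pchar {poly A}] by rewrite pchar_poly.
elim/poly_ind: a => [|a c IH] u.
  have G0 : G 0 = 0 by apply: (addrI (G 0)); rewrite -GD !addr0.
  by rewrite expr0n eqn0Ngt q_gt0 !mul0r G0.
have qn : [pchar {poly A}].-nat q.
  by rewrite (eq_pnat _ (pcharf_eq chP)) pnatX pnat_id ?pr_p.
rewrite (exprDn_pchar _ _ qn) exprMn !mulrDl GD -mulrA IH GX -rmorphXn GC.
by rewrite mulrA.
Qed.

Fact map_Dop_subproof (P : Dop p e A) : map_poly P \in @Dop_pred p e {poly A}.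
Proof.
have P0 := Dop0 P.
apply: Dop_polyP => [u v|c u|u]; apply/polyP => i.
- by rewrite coefD !coef_map_id0// coefD DopD.
- by rewrite coefCM !coef_map_id0// coefCM DopZ.
- rewrite coefXnM coef_map_id0// coefXnM coef_map_id0//.
  by case: ifP.
Qed.

(* [P] acting on coefficients. *)
Definition map_Dop (P : Dop p e A) : Dop p e {poly A} :=
  MkDop (map_Dop_subproof P).

Lemma coef_map_Dop (P : Dop p e A) u i : (map_Dop P u)`_i = P u`_i.
Proof. by rewrite coef_map_id0 ?Dop0. Qed.

Fact map_Dop_zmod : zmod_morphism map_Dop.
Proof.
move=> P P'; apply: Dop_ext => u; apply/polyP => i.
by rewrite coef_map_Dop !sub_DopE coefB !coef_map_Dop.
Qed.

Fact map_Dop_monoid : monoid_morphism map_Dop.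
Proof.
split=> [|P P']; apply: Dop_ext => u; apply/polyP => i.
  by rewrite coef_map_Dop.
by rewrite mul_DopE !coef_map_Dop mul_DopE.
Qed.

HB.instance Definition _ := GRing.isZmodMorphism.Build
  (Dop p e A) (Dop p e {poly A}) map_Dop map_Dop_zmod.
HB.instance Definition _ := GRing.isMonoidMorphism.Build
  (Dop p e A) (Dop p e {poly A}) map_Dop map_Dop_monoid.

Lemma bin_addpX (j m : nat) :
  (m < q)%N -> ('C(q + j, m))%:R = ('C(j, m))%:R :> A.
Proof.
move=> mq; rewrite -binomial.Vandermonde big_ord_recl /= bin0 mul1n subn0 natrD.
rewrite natr_sum big1 ?addr0// => i _; rewrite natrM.
suff /dvdnP[d ->] : (p %| 'C(q, i.+1))%N.
  by rewrite natrM (pcharf0 chA) mulr0 mul0r.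
 have iq : (i.+1 < q)%N.
  by apply: leq_ltn_trans mq; exact: ltn_ord i.
apply: contraT => npC.
have co : coprime q 'C(q, i.+1) by rewrite coprimeXl// prime_coprime.
have : (q %| i.+1 * 'C(q, i.+1))%N by rewrite -mul_bin_diag dvdn_mulr.
by rewrite Gauss_dvdl// => /(dvdn_leq (ltn0Sn _)); rewrite leqNgt iq.
Qed.

Fact hasse_subproof (m : nat) :
  (m < q)%N -> nderivn m \in @Dop_pred p e {poly A}.
Proof.
move=> mq; apply: Dop_polyP => [u v|c u|u].
- exact: nderivnD.
- by rewrite !mul_polyC nderivnZ.
- apply/polyP => i; rewrite coef_nderivn !coefXnM coef_nderivn.
  have [iq|qi] := ltnP i q.
    have [|qmi] := ltnP (m + i) q; first by rewrite mul0rn.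
    rewrite -{2}(subnKC qmi) -mulr_natr bin_addpX// bin_small ?mulr0//.
    by rewrite ltn_subLR// addnC ltn_add2r.
  rewrite ltnNge (leq_trans qi (leq_addl _ _)) /= -addnBA//.
  have -> : (m + i = q + (m + (i - q)))%N by rewrite addnCA subnKC.
  by rewrite -[LHS]mulr_natr bin_addpX// mulr_natr.
Qed.

(* The divided power operator [d_t^[m]], for [m < p ^ e]. *)
Definition hasse (m : nat) (mq : (m < q)%N) : Dop p e {poly A} :=
  MkDop (hasse_subproof mq).

Fact ltn_pexp_ord (l : 'I_e) : (p ^ l < p ^ e)%N.
Proof. by rewrite ltn_exp2l ?prime_gt1. Qed.

(* Indices [l : 'I_e] start from [0], so that [Dt l] is [d_t^[p ^ l]] and
   [theta l] is [d_t^[p ^ l] t^(p ^ l)]. *)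
Definition Dt (l : 'I_e) : Dop p e {poly A} := hasse (ltn_pexp_ord l).

Definition theta (l : 'I_e) : Dop p e {poly A} :=
  Dt l * mulop p e 'X^(p ^ l).

End PolyOps.

Definition Bf (R : idomainType) (f : R) : lmodType {poly R} :=
  locquot (f%:P - 'X).

(* The same abelian group as a module over [R], [D_{R[t]}^e] and [D_R^e]. *)
Definition Bf_R (R : idomainType) (f : R) : lmodType R := restr polyC (Bf f).

Definition Bf_DRt (R : idomainType) (p : nat) (chR : p \in [pchar R]) (e : nat)
    (f : R) : lmodType (Dop p e {poly R}) :=
  locquotD (pcharf_prime chR) e (f%:P - 'X).

Definition Bf_DR (R : idomainType) (p : nat) (chR : p \in [pchar R]) (e : nat)
    (f : R) : lmodType (Dop p e R) :=
  restr (map_Dop chR (e := e)) (Bf_DRt chR e f).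

Definition Bcomp (R : idomainType) (p : nat) (chR : p \in [pchar R]) (e : nat)
    (f : R) (i : 'I_e -> nat) : set (Bf f) :=
  [set w | forall l : 'I_e,
     theta chR l *: (w : Bf_DRt chR e f) = - ((w : Bf_DRt chR e f) *+ i l)].

(* [p - i l - 1] is a truncated subtraction: the entries [i l] are assumed to be
   less than [p]. *)
Definition Qcl (R : idomainType) (p e : nat) (f : R) (i : 'I_e -> nat)
    (m : nat) : Bf f :=
  lclass (lfrac (f%:P - 'X)
    'X^(\sum_(l < e) (p - i l - 1) * p ^ l) (m.+1 * p ^ e)).

Arguments Bcomp {R p} chR {e} f i.
Arguments Qcl {R} p {e} f i m.

(* Main.v *)
(* With q = p ^ e and g = f - t, one has g ^ q = f ^ q - t ^ q, so R[t] is free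
   over R[g ^ q] on t ^ s for s < q, and hence B_f is R-free on the classes of
   t ^ s / g ^ (m q) for s < q and m >= 1.  By Lucas' theorem theta_(p ^ l)
   multiplies t ^ r by one plus the l-th base p digit of r, so it is diagonal in
   this basis, and the digits of s are determined by the eigenvalues: the
   component cut out by i is spanned by the classes with
   s = \sum_l (p - i_l - 1) p ^ l.  The remaining formulas are base p
   carrying. *)

Require Import Defs.
From HB Require Import structures.
From mathcomp Require Import all_boot all_order all_algebra.
From mathcomp Require Import ring_quotient.
From mathcomp Require Import boolp classical_sets functions.
From mathcomp Require Import zify.

Set Implicit Arguments.
Unset Strict Implicit.
Unset Printing Implicit Defensive.

Import GRing.Theory.
Local Open Scope ring_scope.

(** * Base [p] digits and carries *)

Section Digits.
Local Open Scope nat_scope.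
Variables (p : nat) (p_gt1 : 1 < p).

Lemma sum_pred_expn (l k : nat) :
  l <= k -> \sum_(l <= j < k) p.-1 * p ^ j + p ^ l = p ^ k.
Proof.
elim: k => [|k IHk]; first by rewrite leqn0 => /eqP->; rewrite big_geq.
rewrite leq_eqVlt => /predU1P[->|lk]; first by rewrite big_geq.
rewrite big_nat_recr//= addnAC IHk// -mulSn prednK ?expnS//.
exact: ltnW.
Qed.

Lemma sum_ord_nat_interval (e l k : nat) (F : nat -> nat) :
  k <= e -> \sum_(j < e | l <= j < k) F j = \sum_(l <= j < k) F j.
Proof. by move=> ke; rewrite big_geq_mkord (big_ord_widen_cond e). Qed.

Lemma digit_sum (e : nat) (d : 'I_e -> nat) (l : 'I_e) :
  (forall j, d j < p) -> (\sum_(j < e) d j * p ^ j) %/ p ^ l %% p = d l.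
Proof.
elim: e d l => [d []//|e IHe] d l dp.
have E : \sum_(j < e.+1) d j * p ^ j =
    (\sum_(j < e) d (lift ord0 j) * p ^ j) * p + d ord0.
  rewrite big_ord_recl muln1 addnC big_distrl; congr (_ + _).
  by apply: eq_bigr => j _; rewrite expnSr mulnA.
rewrite E; have [l' ->|->] := unliftP ord0 l; last first.
  by rewrite divn1 modnMDl modn_small.
rewrite expnS divnMA divnMDl ?(ltnW p_gt1)// (divn_small (dp ord0)) addn0.
exact: IHe.
Qed.

Lemma sum_digits (e n : nat) (d : 'I_e -> nat) :
  (forall j : 'I_e, n %/ p ^ j %% p = d j) ->
  n %% p ^ e = \sum_(j < e) d j * p ^ j.
Proof.
elim: e n d => [|e IHe] n d nd; first by rewrite big_ord0 modn1.
rewrite big_ord_recl muln1 -(nd ord0) divn1.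
rewrite {1}(divn_eq (n %% p ^ e.+1) p) expnSr -modn_divl.
rewrite modn_dvdm ?dvdn_mull// addnC; congr (_ + _).
rewrite (IHe (n %/ p) (fun j => d (lift ord0 j))) ?big_distrl/= => [|j].
  by apply: eq_bigr => j _; rewrite expnSr mulnA.
by rewrite -nd -divnMA -expnS.
Qed.

(* The digits are [p - i j - 1], so the zero entries of [i] before position [k]
   are digits [p - 1], which carry. *)
Lemma sum_codigits_carry (e : nat) (i : 'I_e -> nat) (l k : 'I_e) :
    (forall j, i j < p) -> l <= k -> i k <> 0 ->
    (forall j : 'I_e, l <= j < k -> i j = 0) ->
  p ^ l + \sum_(j < e) (p - i j - 1) * p ^ j =
  \sum_(j < e) (p - (if l <= j < k then p.-1
                     else if j == k then (i k).-1 else i j) - 1) * p ^ j.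
Proof.
move=> ip lk ik i0.
pose block (j : 'I_e) := l <= j < k.
rewrite (bigID block) [RHS](bigID block) /block /=.
rewrite (eq_bigr (fun j : 'I_e => p.-1 * p ^ j)) => [|j /i0->]; last first.
  by congr (_ * _); lia.
rewrite (@sum_ord_nat_interval e l k (fun j => p.-1 * p ^ j)) 1?ltnW//.
(* Adding [p ^ l] to a block of digits [p.-1] leaves a single [p ^ k], the carry into position [k];
   on the right the block consists of zero digits. *)
rewrite addnA [p ^ l + _]addnC sum_pred_expn//.
rewrite [X in _ = X + _]big1 => [|j ->]; last first.
  by rewrite [X in X * _](_ : _ = 0)//; lia.
rewrite (bigD1 k)/= ?ltnn ?andbF// [in RHS](bigD1 k)/= ?ltnn ?andbF//.
rewrite eqxx addnA -mulSn; congr (_ * _ + _).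
  by have := ip k; lia.
by apply: eq_bigr => j /andP[/negPf-> /negPf->].
Qed.

(** All digits from position [l] upwards are [p - 1], so the carry leaves the top position as
    [p ^ e] and these digits drop to zero. *)
Lemma sum_codigits_overflow (e : nat) (i : 'I_e -> nat) (l : 'I_e) :
    (forall j : 'I_e, l <= j -> i j = 0) ->
  p ^ l + \sum_(j < e) (p - i j - 1) * p ^ j =
  p ^ e + \sum_(j < e) (p - (if l <= j then p.-1 else i j) - 1) * p ^ j.
Proof.
move=> i0.
pose block (j : 'I_e) := l <= j < e.
rewrite (bigID block) [in RHS](bigID block) /block /=.
rewrite (eq_bigr (fun j : 'I_e => p.-1 * p ^ j)) => [|j /andP[/i0-> _]];
  last by congr (_ * _); lia.
rewrite (@sum_ord_nat_interval e l e (fun j => p.-1 * p ^ j))//.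
rewrite addnA [p ^ l + _]addnC sum_pred_expn 1?ltnW//.
rewrite [X in _ + (X + _)]big1 => [|j /andP[-> _]]; last first.
  by rewrite [X in X * _](_ : _ = 0)//; lia.
congr (_ + _); apply: eq_bigr => j.
by rewrite ltn_ord andbT => /negPf->.
Qed.

(** The bound on [i l] makes the digit in position [l] positive, so one unit is taken from it
    without borrowing. *)
Lemma sum_codigits_incr (e : nat) (i : 'I_e -> nat) (l : 'I_e) :
    (i l).+1 < p ->
  \sum_(j < e) (p - i j - 1) * p ^ j =
  p ^ l + \sum_(j < e) (p - (if j == l then (i l).+1 else i j) - 1) * p ^ j.
Proof.
move=> il; rewrite (bigD1 l)//= [in RHS](bigD1 l)//= eqxx addnA -mulSn.
congr (_ * _ + _); first by lia.
by apply: eq_bigr => j /negPf->.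
Qed.

End Digits.

(* Lucas' theorem for the single digit in position [l]. *)
Lemma bin_pexp (A : comNzRingType) (p : nat) (chA : p \in [pchar A])
    (n l : nat) : ('C(n, p ^ l))%:R = (n %/ p ^ l)%:R :> A.
Proof.
have pr_p := pcharf_prime chA.
have q0 : (0 < p ^ l)%N by rewrite expn_gt0 prime_gt0.
(* In Vandermonde's sum only the two outer terms survive: the inner ones contain ['C(p ^ l, i)] with
   [0 < i < p ^ l], which vanishes in characteristic [p]. *)
have step j : ('C(p ^ l + j, p ^ l))%:R = ('C(j, p ^ l))%:R + 1 :> A.
  rewrite -binomial.Vandermonde big_ord_recr /= subnn bin0 muln1 binn natrD.
  congr (_ + _); case: (p ^ l)%N q0 (@bin_addpX A p chA l 0) => // q _ H.
  rewrite big_ord_recl /= bin0 mul1n subn0 natrD natr_sum big1 ?addr0// => i _.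
  rewrite natrM -[X in 'C(X, _)]addn0 H ?bin0n ?mul0r//.
  exact: ltn_ord i.
rewrite {1}(divn_eq n (p ^ l)); elim: (n %/ _)%N => [|m IHm].
  by rewrite add0n bin_small// ltn_mod.
by rewrite mulSn -addnA step IHm -natr1.
Qed.

(** * Classes of fractions modulo [A] *)

Section LocalizationQuotient.
Variables (A : idomainType) (g : A).
Hypothesis g_neq0 : g != 0.

Lemma lclass_lfracD (h h' : A) (n : nat) :
  lclass (lfrac g h n) + lclass (lfrac g h' n) = lclass (lfrac g (h + h') n).
Proof. by rewrite -lclassD lfrac_same. Qed.

Lemma scale_lclass_lfrac (a h : A) (n : nat) :
  a *: lclass (lfrac g h n) = lclass (lfrac g (a * h) n).
Proof.
by rewrite scale_lclass; congr lclass; apply: val_inj; rewrite /= tofracM mulrA.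
Qed.

Lemma lclass_lfrac0 (n : nat) : lclass (lfrac g 0 n) = 0.
Proof. by rewrite -[0 in LHS](mul0r 0) -scale_lclass_lfrac scale0r. Qed.

Lemma lclass_lfracN (h : A) (n : nat) :
  - lclass (lfrac g h n) = lclass (lfrac g (- h) n).
Proof. by rewrite -scaleN1r scale_lclass_lfrac mulN1r. Qed.

Lemma lclass_lfracMn (h : A) (n k : nat) :
  lclass (lfrac g h n) *+ k = lclass (lfrac g (h *+ k) n).
Proof. by rewrite -scaler_nat scale_lclass_lfrac mulr_natl. Qed.

Lemma lclass_lfrac_sum (n k : nat) (F : nat -> A) :
  \sum_(j < k) lclass (lfrac g (F j) n) = lclass (lfrac g (\sum_(j < k) F j) n).
Proof.
elim: k => [|k IHk]; first by rewrite !big_ord0 lclass_lfrac0.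
by rewrite !big_ord_recr/= IHk lclass_lfracD.
Qed.

Lemma lfracM_exp (h : A) (n k : nat) :
  lfrac g (g ^+ k * h) (k + n) = lfrac g h n.
Proof.
apply: val_inj; rewrite /= tofracM tofracXn exprD -mulf_div divff ?mul1r//.
by rewrite expf_neq0 ?tofrac_eq0.
Qed.

Lemma lclass_lfrac_eq0 (h : A) (n : nat) :
  lclass (lfrac g h n) = 0 <-> exists a, h = a * g ^+ n.
Proof.
rewrite -(lclass_lfrac0 0); split=> [/lclass_eq[a]|[a ->]].
  move/(congr1 val); rewrite rmorphB /= tofrac0 mul0r subr0 => E; exists a.
  apply/eqP; rewrite -tofrac_eq tofracM tofracXn -E divfK//.
  by rewrite expf_neq0 ?tofrac_eq0.
apply/lclass_eq; exists a; apply: val_inj.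
rewrite rmorphB /= tofrac0 mul0r subr0 tofracM tofracXn mulfK//.
by rewrite expf_neq0 ?tofrac_eq0.
Qed.

End LocalizationQuotient.

(** * Reduced numerators in [Bf f] *)

Section Components.
Variables (R : idomainType) (p : nat) (chR : p \in [pchar R]) (f : R) (e : nat).

Local Notation q := (p ^ e)%N.
Local Notation g := (f%:P - 'X).
Local Notation cls h N := (lclass (lfrac g h (N * p ^ e)) : Bf f).
Local Notation S i := (\sum_(l < e) (p - i l - 1) * p ^ l)%N.

Let pr_p : prime p := pcharf_prime chR.
Let p_gt1 : (1 < p)%N := prime_gt1 pr_p.
Let q_gt0 : (0 < q)%N. Proof. by rewrite expn_gt0 prime_gt0. Qed.

Lemma size_polyC_subX : size g = 2%N.
Proof. by rewrite -opprB size_polyN size_XsubC. Qed.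

Let g_neq0 : g != 0. Proof. by rewrite -size_poly_eq0 size_polyC_subX. Qed.

Lemma size_polyC_subX_exp n : size (g ^+ n) = n.+1.
Proof.
rewrite -[LHS]prednK ?size_exp ?size_polyC_subX ?mul1n//.
by rewrite size_poly_gt0 expf_neq0.
Qed.

(** Up to sign [g] is monic; this permits Euclidean division by its powers over the domain [R]. *)
Lemma lead_coef_polyC_subX_unit n : lead_coef (g ^+ n) \is a GRing.unit.
Proof.
by rewrite lead_coef_exp -opprB lead_coefN lead_coefXsubC unitrX// unitrN1.
Qed.

Lemma polyC_subX_pexp : g ^+ q = (f ^+ q)%:P - 'X^q.
Proof.
have qn : [pchar {poly R}].-nat q.
  have chP : p \in [pchar {poly R}] by rewrite pchar_poly.
  by rewrite (eq_pnat _ (pcharf_eq chP)) pnatX pnat_id ?pr_p.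
by rewrite (exprDn_pchar _ _ qn) (exprNn_pchar _ qn) rmorphXn.
Qed.

(** A nonzero multiple of [g ^+ (N * q)] has degree at least [N * q]. Reduced numerators are
    therefore unique, and equations in [Bf f] can be checked on coefficients. *)
Lemma lclass_small_eq0 (h : {poly R}) N :
  (size h <= N * q)%N -> cls h N = 0 -> h = 0.
Proof.
move=> sh /(lclass_lfrac_eq0 g_neq0)[a E].
have [a0|a0] := eqVneq a 0; first by rewrite E a0 mul0r.
move: sh; rewrite E size_mul ?expf_neq0// size_polyC_subX_exp addnS /=.
by rewrite leqNgt -[X in (X < _)%N]add0n ltn_add2r size_poly_gt0 a0.
Qed.

(** Divide the numerator by the denominator: the quotient is a polynomial, so its class is zero and
    the remainder suffices. *)
Lemma lclass_small (w : Bf f) :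
  exists (h : {poly R}) N, (size h <= N * q)%N /\ w = cls h N.
Proof.
have [h [N ->]] := @lclassD_surj p pr_p e _ g w.
exists (h %% g ^+ (N * q)), N; split.
  by rewrite -ltnS -(size_polyC_subX_exp (N * q)) ltn_modp expf_neq0.
rewrite {1}(Pdiv.IdomainUnit.divp_eq (lead_coef_polyC_subX_unit (N * q)) h).
rewrite -lclass_lfracD [X in X + _](_ : _ = 0) ?add0r//.
by apply/(lclass_lfrac_eq0 g_neq0); exists (h %/ g ^+ (N * q)).
Qed.

(** * Eigenvalues of the operators [theta] *)

Lemma scale_DopE (P : Dop p e {poly R}) (h : {poly R}) N :
  P *: (cls h N : Bf_DRt chR e f) = cls (P h) N.
Proof. exact: scaleD_lclass. Qed.

(** The factor at ['X^r] is the binomial coefficient ['C(p ^ l + r, p ^ l)], evaluated by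
    [bin_pexp]. *)
Lemma coef_theta (l : 'I_e) (h : {poly R}) r :
  (theta chR l h)`_r = h`_r *+ (r %/ p ^ l).+1.
Proof.
rewrite /theta mul_DopE /= coef_nderivn coefXnM ltnNge leq_addr/= addKn.
rewrite -mulr_natr (bin_pexp chR) divnDl// divnn expn_gt0 prime_gt0//.
by rewrite add1n mulr_natr.
Qed.

Lemma Bcomp_lclassP (i : 'I_e -> nat) (i_lt : forall l, (i l < p)%N)
    (h : {poly R}) N : (size h <= N * q)%N ->
  Bcomp chR f i (cls h N) <-> forall r, h`_r != 0 -> (r %% q = S i)%N.
Proof.
move=> sh.
(* [theta] is diagonal on monomials and keeps the numerator reduced, so the eigenvalue equation
   lifts from classes to polynomials. *)
have thE (l : 'I_e) : theta chR l *: (cls h N : Bf_DRt chR e f) =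
    - ((cls h N : Bf_DRt chR e f) *+ i l) <-> theta chR l h + h *+ i l = 0.
  rewrite scale_DopE.
  have sth : (size (theta chR l h + h *+ i l)%R <= N * q)%N.
    apply/leq_sizeP => r /(leq_trans sh) hr.
    by rewrite coefD coefMn coef_theta nth_default// !mul0rn addr0.
  split=> [/eqP|E].
    rewrite -addr_eq0 => /eqP; rewrite [X in _ + X]lclass_lfracMn lclass_lfracD.
    exact: lclass_small_eq0.
  apply/eqP; rewrite -addr_eq0 [X in _ + X]lclass_lfracMn lclass_lfracD.
  by rewrite E lclass_lfrac0.
(* The divisibility says that digit [l] of [r] is [p - i l - 1]. *)
have digit r : (r %% q = S i)%N <->
    forall l : 'I_e, (p %| (r %/ p ^ l).+1 + i l)%N.
  split=> [E l|H].
    have dl : (r %/ p ^ l %% p = p - i l - 1)%N.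
      rewrite -(@digit_sum p p_gt1 e (fun l => (p - i l - 1)%N) l) => [|j];
        last by have := i_lt j; lia.
      rewrite -E !modn_divl -expnS modn_dvdm//.
      by rewrite dvdn_exp2l.
    rewrite (divn_eq (r %/ p ^ l) p) dl -addnS -addnA.
    by rewrite dvdn_addr ?dvdn_mull//; apply/dvdnP; exists 1%N;
      have := i_lt l; lia.
  apply: sum_digits => l; have il := i_lt l.
  (* The dividend is positive, so it is [k.+1 * p]; one [p] is spent on the digit. *)
  have /dvdnP[[|k] E] := H l; first by rewrite mul0n addSn in E.
  rewrite (_ : _ %/ _ = k * p + (p - i l - 1))%N; last first.
    by move: E; rewrite mulSn; move: (r %/ p ^ l)%N (k * p)%N; lia.
  by rewrite modnMDl modn_small//; lia.
split=> [H r hr|H l].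
  apply/digit => l; have /thE/(congr1 (fun u : {poly R} => u`_r)) := H l.
  rewrite coefD coefMn coef_theta coef0 -mulrnDr -mulr_natr => /eqP.
  by rewrite mulf_eq0 (negPf hr)/= -(dvdn_pcharf chR).
apply/thE/polyP => r; rewrite coefD coefMn coef_theta coef0 -mulrnDr.
have [->|hr] := eqVneq h`_r 0; first by rewrite mul0rn.
have /digit/(_ l) := H r hr.
by rewrite (dvdn_pcharf chR) => /eqP E; rewrite -mulr_natr E mulr0.
Qed.

(** Its own coefficients are its digits by [digit_sum], so [sum_digits] identifies the sum with its
    residue modulo [q]. *)
Lemma codigits_lt (i : 'I_e -> nat) : (S i < q)%N.
Proof.
suff -> : (S i = S i %% q)%N by rewrite ltn_mod.
symmetry; apply: (sum_digits (d := fun j => (p - i j - 1)%N)) => j.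
by apply: (@digit_sum p p_gt1 e (fun l => (p - i l - 1)%N)) => l; lia.
Qed.

(** * The [R]-basis of a component *)

Lemma scale_Bf_R (c : R) (h : {poly R}) N :
  c *: (cls h N : Bf_R f) = cls (c *: h) N.
Proof. by rewrite -mul_polyC; exact: scale_lclass_lfrac. Qed.

(** Over the common denominator [g ^+ (n * q)] the term of index [m] gains the factor
    [(g ^+ q) ^+ (n - m.+1)]; hence the reversed coefficients. *)
Lemma Qcl_sum (i : 'I_e -> nat) (n : nat) (c : nat -> R) :
  \sum_(m < n) c m *: (Qcl p f i m : Bf_R f) =
  cls ('X^(S i) * ((\poly_(m < n) c (n - m.+1)%N) \Po g ^+ q)) n.
Proof.
rewrite poly_def raddf_sum /= mulr_sumr.
rewrite (eq_bigr (fun m : 'I_n => cls ('X^(S i) *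
   (c m *: (g ^+ q) ^+ (n - m.+1))) n)) => [|m _]; last first.
  rewrite scale_Bf_R -(@lfracM_exp _ _ g_neq0 _ _ ((n - m.+1) * q)%N).
  by rewrite -mulnDl subnK// -exprM mulnC -!scalerAr mulrC.
rewrite (@lclass_lfrac_sum _ g _ n (fun m => 'X^(S i) *
   (c m *: (g ^+ q) ^+ (n - m.+1)))).
congr (lclass (lfrac _ _ _)).
rewrite (reindex_inj rev_ord_inj); apply: eq_bigr => m _ /=.
by rewrite comp_polyZ comp_Xn_poly subnSK// subKn// ltnW.
Qed.

(** Since [g ^+ q] is [f ^+ q - 'X^q], this passes from polynomials in [g ^+ q] to polynomials in
    ['X^q], whose coefficients are visible. *)
Lemma comp_poly_subX_pexp (k : {poly R}) :
  k \Po g ^+ q = (k \Po ((f ^+ q)%:P - 'X)) \Po 'X^q.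
Proof.
by rewrite polyC_subX_pexp -comp_polyA comp_polyB comp_polyC comp_polyX.
Qed.

Lemma size_Xn_comp_poly (i : 'I_e -> nat) (k : {poly R}) n :
  (size k <= n)%N -> (size ('X^(S i) * (k \Po g ^+ q))%R <= n * q)%N.
Proof.
have [->|k0] := eqVneq k 0; first by rewrite comp_poly0 mulr0 size_poly0.
move=> kn; rewrite (leq_trans (size_polyMleq _ _))// size_polyXn addSn /=.
have := size_comp_poly_leq k (g ^+ q); rewrite size_polyC_subX_exp /=.
have Sq := codigits_lt i; move: k0; rewrite -size_poly_gt0.
case: (size k) kn => // s sn _ /= H.
rewrite (leq_trans (leq_add (leqnn _) H))// addnS -addSn.
by rewrite (leq_trans _ (leq_mul sn (leqnn q)))// mulSn leq_add2r.
Qed.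

(** The common numerator is reduced, hence zero; the power of ['X] cancels, and composition with the
    nonconstant [g ^+ q] is injective. *)
Lemma Qcl_free (i : 'I_e -> nat) (n : nat) (c : nat -> R) :
  \sum_(m < n) c m *: (Qcl p f i m : Bf_R f) = 0 -> forall m : 'I_n, c m = 0.
Proof.
rewrite Qcl_sum => /(lclass_small_eq0).
move=> /(_ (size_Xn_comp_poly _ (size_poly _ _)))/eqP.
rewrite mulf_eq0 expf_eq0 polyX_eq0 andbF /=.
rewrite comp_poly_eq0 ?size_polyC_subX_exp// => /eqP E m.
have := congr1 (fun u : {poly R} => u`_(n - m.+1)) E.
rewrite /= coef_poly coef0 ltn_subrL (leq_ltn_trans _ (ltn_ord m))//.
by rewrite subnSK ?subKn// ltnW.
Qed.

Lemma Bcomp_span (i : 'I_e -> nat) (i_lt : forall l, (i l < p)%N) (w : Bf f) :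
  Bcomp chR f i w <-> exists (n : nat) (c : nat -> R),
    w = \sum_(m < n) c m *: (Qcl p f i m : Bf_R f).
Proof.
split=> [|[n [c ->]]]; last first.
  rewrite Qcl_sum; apply/(Bcomp_lclassP i_lt).
    exact: size_Xn_comp_poly (size_poly _ _).
  move=> r; rewrite comp_poly_subX_pexp coefXnM coef_comp_poly_Xn//.
  case: ltnP => [|Sr]; first by rewrite eqxx.
  case: ifP => [/dvdnP[d E] _|]; last by rewrite eqxx.
  by rewrite -(subnK Sr) E modnMDl modn_small// codigits_lt.
have [h [N [sh ->]]] := lclass_small w.
move/(Bcomp_lclassP i_lt sh) => H.
(* Only exponents congruent to [S i] modulo [q] occur in [h], so [h] is ['X^(S i)] times [k0]
   evaluated at ['X^q]; [k] re-expands this in powers of [g ^+ q]. *)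
pose k0 := \poly_(j < N) h`_(S i + j * q).
pose k := k0 \Po ((f ^+ q)%:P - 'X).
have sk : (size k <= N)%N.
  by rewrite size_comp_poly2 ?size_poly// -opprB size_polyN size_XsubC.
(* This reversal undoes the one in [Qcl_sum]. *)
exists N, (fun m => k`_(N - m.+1)).
rewrite (Qcl_sum _ _ (fun m => k`_(N - m.+1))).
have -> : \poly_(m < N) k`_(N - (N - m.+1).+1) = k.
  apply/polyP => m; rewrite coef_poly; case: ltnP => [mN|Nm].
    by rewrite subnSK// subKn// ltnW.
  by rewrite nth_default// (leq_trans sk).
congr (lclass (lfrac _ _ _)); rewrite comp_poly_subX_pexp.
(* Substituting [f ^+ q - 'X] for ['X] is an involution. *)
have -> : k \Po ((f ^+ q)%:P - 'X) = k0.
  by rewrite -comp_polyA comp_polyB comp_polyC comp_polyX subKr comp_polyXr.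
apply/polyP => r; rewrite coefXnM coef_comp_poly_Xn//.
have [hr|/H hr] := eqVneq h`_r 0.
  case: ltnP => // Sr; case: ifP => // /dvdnP[d E].
  by rewrite E mulnK// coef_poly -E subnKC// hr if_same.
rewrite -hr ltnNge leq_mod /=.
have E : (r - r %% q = r %/ q * q)%N by rewrite {1}(divn_eq r q) addnK.
rewrite E dvdn_mull// mulnK// coef_poly -hr addnC -divn_eq.
case: ltnP => // Nr; rewrite nth_default// (leq_trans sh)//.
by rewrite (leq_trans (leq_mul Nr (leqnn q)))// leq_trunc_div.
Qed.

(** * Divided powers and multiplication by powers of [t] *)

Lemma Dt_Qcl (i : 'I_e -> nat) (i_lt : forall l, (i l < p)%N) (l : 'I_e) m :
  Dt chR l *: (Qcl p f i m : Bf_DRt chR e f) =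
  if i l == p.-1 then 0
  else - (Qcl p f (fun j => if j == l then (i l).+1 else i j) m *+ (i l).+1).
Proof.
have chP : p \in [pchar {poly R}] by rewrite pchar_poly.
(* Modulo [p] the binomial coefficient is digit [l] of [S i], namely [p - i l - 1]. *)
have E : ('C(S i, p ^ l))%:R = - (i l).+1%:R :> {poly R}.
  rewrite (bin_pexp chP) (divn_eq (S i %/ p ^ l) p) natrD natrM (pcharf0 chP).
  rewrite mulr0 add0r.
  rewrite (@digit_sum p p_gt1 e (fun l => (p - i l - 1)%N)) => [|j];
    last by have := i_lt j; lia.
  by rewrite subn1 -subnS natrB// (pcharf0 chP) sub0r.
rewrite [LHS]scale_DopE /= nderivnXn -mulr_natr E.
have [il|il] := eqVneq (i l) p.-1.
  rewrite il prednK ?prime_gt0// (pcharf0 chP) oppr0 mulr0.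
  exact: lclass_lfrac0.
rewrite mulrN mulr_natr -lclass_lfracN -lclass_lfracMn.
rewrite (@sum_codigits_incr p p_gt1 e i l) ?addKn//.
by have := i_lt l; lia.
Qed.

Lemma scaleXn_Qcl (i i' : 'I_e -> nat) n m :
  (n + S i = S i')%N -> 'X^n *: Qcl p f i m = Qcl p f i' m.
Proof. by rewrite /Qcl => <-; rewrite scale_lclass_lfrac exprD. Qed.

(** The overflow ['X^q] equals [f ^+ q - g ^+ q], and the factor [g ^+ q] lowers the pole order by
    one step, from [m] to [m - 1]. *)
Lemma scaleXn_Qcl_overflow (i i' : 'I_e -> nat) n m :
  (n + S i = q + S i')%N ->
  'X^n *: Qcl p f i m = f ^+ q *: (Qcl p f i' m : Bf_R f)
    - (if m is m'.+1 then Qcl p f i' m' else 0).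
Proof.
move=> E; rewrite [LHS]scale_lclass_lfrac -exprD E exprD.
have -> : 'X^q = (f ^+ q)%:P - g ^+ q.
  by rewrite polyC_subX_pexp subKr.
rewrite mulrBl -lclass_lfracD -lclass_lfracN -scale_lclass_lfrac.
(* For [m = 0] the factor [g ^+ q] cancels the whole denominator and leaves a polynomial, whose
   class is zero. *)
congr (_ - _); rewrite mulSn; case: m => [|m].
  apply/(lclass_lfrac_eq0 g_neq0); exists 'X^(S i').
  by rewrite mul0n addn0 mulrC.
by rewrite lfracM_exp.
Qed.

(** * The [D_R^e]-module generated by one basis element *)

Lemma scale_DR_Qcl (i : 'I_e -> nat) m (P : Dop p e R) (c : R) :
  P *: ((c *: (Qcl p f i m : Bf_R f)) : Bf_DR chR e f) =
  P c *: (Qcl p f i m : Bf_R f).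
Proof.
rewrite /Qcl !scale_Bf_R [LHS](scale_DopE (map_Dop chR P)).
(* The numerator is a monomial, so [P] meets only the coefficient [c] and zeros. *)
congr (lclass (lfrac _ _ _)); apply/polyP => r.
rewrite coef_map_Dop !coefZ coefXn.
by case: eqP; rewrite ?mulr1 ?mulr0 ?Dop0.
Qed.

Lemma scale_Qcl_inj (i : 'I_e -> nat) m :
  injective (fun c : R => c *: (Qcl p f i m : Bf_R f)).
Proof.
move=> c d /eqP; rewrite -subr_eq0 -scalerBl /Qcl scale_Bf_R => /eqP.
move/(lclass_small_eq0).
rewrite (leq_trans (size_scale_leq _ _)); last first.
  by rewrite size_polyXn mulSn ltn_addr// codigits_lt.
move=> /(_ isT)/eqP; rewrite scale_poly_eq0 subr_eq0.
by rewrite expf_eq0 polyX_eq0 andbF orbF => /eqP.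
Qed.

Lemma cyclic_sub_Qcl_submodule (i : 'I_e -> nat) m :
  is_submodule (cyclic_sub (Qcl p f i m : Bf_R f) : set (Bf_DR chR e f)).
Proof.
split.
- by exists 0; rewrite scale0r.
- by move=> _ _ [c ->] [d ->]; exists (c + d); rewrite scalerDl.
- by move=> P _ [c ->]; exists (P c); rewrite scale_DR_Qcl.
Qed.

Lemma cyclic_sub_Qcl_iso (i : 'I_e -> nat) m :
  exists phi : Bf_DR chR e f -> Dreg p e R,
    is_module_iso (cyclic_sub (Qcl p f i m : Bf_R f) : set (Bf_DR chR e f)) phi
    /\ phi (Qcl p f i m) = (1 : R).
Proof.
(* [phi] reads off the coefficient, unique by [scale_Qcl_inj]; outside the cyclic submodule it takes
   the default value [0]. *)
pose phi (w : Bf_R f) : R := xget 0 [set c | w = c *: (Qcl p f i m : Bf_R f)].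
have phiE c : phi (c *: (Qcl p f i m : Bf_R f)) = c.
  by apply: xget_subset1 => // a b /= -> /scale_Qcl_inj.
exists phi; split; last by rewrite -[X in phi X]scale1r phiE.
split.
- by move=> _ _ [c ->] [d ->]; rewrite -[X in phi X]scalerDl !phiE.
- by move=> P _ [c ->]; rewrite scale_DR_Qcl !phiE.
- by move=> _ _ [c ->] [d ->]; rewrite !phiE => ->.
- by move=> y; exists (y *: (Qcl p f i m : Bf_R f)); [exists y | exact: phiE].
Qed.

End Components.

Theorem theorem5p5 (R : idomainType) (p : nat) (chR : p \in [pchar R])
    (R_reg : regular R) (R_Ffin : F_finite chR) (f : R) (f_neq0 : f != 0)
    (e : nat) (e_ge1 : (1 <= e)%N)
    (i : 'I_e -> nat) (i_lt : forall l : 'I_e, (i l < p)%N) :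
  is_basis (Bcomp chR f i : set (Bf_R f)) (Qcl p f i : nat -> Bf_R f) /\
  (forall (l : 'I_e) (m : nat),
     Dt chR l *: (Qcl p f i m : Bf_DRt chR e f) =
     if i l == p.-1 then 0
     else - (Qcl p f (fun j => if j == l then (i l).+1 else i j) m
               *+ (i l).+1)) /\
  (forall (l : 'I_e) (m : nat) (k : 'I_e),
     (l <= k)%N -> i k <> 0%N ->
     (forall j : 'I_e, (l <= j < k)%N -> i j = 0%N) ->
     'X^(p ^ l) *: Qcl p f i m =
     Qcl p f (fun j => if (l <= j < k)%N then p.-1
                       else if j == k then (i k).-1 else i j) m) /\
  (forall (l : 'I_e) (m : nat),
     (forall j : 'I_e, (l <= j)%N -> i j = 0%N) ->
     let i' := fun j : 'I_e => if (l <= j)%N then p.-1 else i j in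
     'X^(p ^ l) *: Qcl p f i m =
     f ^+ (p ^ e) *: (Qcl p f i' m : Bf_R f)
       - (if m is m'.+1 then Qcl p f i' m' else 0)) /\
  (forall m : nat,
     let RQ : set (Bf_DR chR e f) := cyclic_sub (Qcl p f i m : Bf_R f) in
     is_submodule RQ /\
     exists phi : Bf_DR chR e f -> Dreg p e R,
       is_module_iso RQ phi /\ phi (Qcl p f i m) = (1 : R)).
Proof.
have p_gt1 := prime_gt1 (pcharf_prime chR).
split; first by split=> [n c|w]; [exact: Qcl_free | exact: Bcomp_span].
split; first by move=> l m; exact: Dt_Qcl.
split=> [l m k lk ik i0|].
  by apply: scaleXn_Qcl; exact: sum_codigits_carry.
split=> [l m i0 /=|m /=].
  by apply: (scaleXn_Qcl_overflow chR); exact: sum_codigits_overflow.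
by split; [exact: cyclic_sub_Qcl_submodule | exact: cyclic_sub_Qcl_iso].
Qed.
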